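(* Every stratifiable space is DH$^+$-separable.
   Context: A space $X$ is stratifiable if one can assign to every $n\in\omega$ and every closed set $H\subset X$ an open set $G(n,H)\supset H$ so that $H=\bigcap_{n\in\omega}\overline{G(n,H)}$ and $G(n,H)\subset G(n,K)$ whenever $H\subset K$. A subset of $X$ is called discrete if it is discrete in its subspace topology. $X$ is DH$^+$-separable if player Two has a winning strategy in the following game of length $\omega$ on $X$: at inning $n$, One picks a dense $D_n\subset X$, then Two picks a discrete set $F_n\subset D_n$; Two wins if every non-empty open set in $X$ intersects all but finitely many $F_n$. *)

(* Defs.v *)
From HB Require Import structures.
From mathcomp Require Import all_boot all_order all_algebra.
From mathcomp Require Import all_classical all_reals topology.

Set Implicit Arguments.
Unset Strict Implicit.
Unset Printing Implicit Defensive.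

Local Open Scope classical_set_scope.

(* [G n H] is only constrained when [H] is closed. *)
Definition stratification (X : topologicalType) (G : nat -> set X -> set X) :=
  [/\ forall n H, closed H -> open (G n H) /\ H `<=` G n H,
      forall H, closed H -> H = \bigcap_n closure (G n H)
    & forall n H K, closed H -> closed K -> H `<=` K -> G n H `<=` G n K].

Definition stratifiable (X : topologicalType) :=
  exists G : nat -> set X -> set X, stratification G.

(* [set_type F] carries the topology induced by the inclusion into [X]. *)
Definition discrete_subset (X : topologicalType) (F : set X) :=
  forall B : set (set_type F), open B.

(* A strategy for Two maps the moves D_0, ..., D_n made by One so far to Two's
   answer F_n. *)
Definition two_strategy (X : topologicalType) := seq (set X) -> set X.

Definition two_answer (X : topologicalType) (s : two_strategy X)
  (D : nat -> set X) (n : nat) : set X := s (mkseq D n.+1).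

Definition legal_two_strategy (X : topologicalType) (s : two_strategy X) :=
  forall (D : nat -> set X) (n : nat), (forall i, i <= n -> dense (D i)) ->
    two_answer s D n `<=` D n /\ discrete_subset (two_answer s D n).

Definition two_wins (X : topologicalType) (F : nat -> set X) :=
  forall U : set X, open U -> U !=set0 ->
    finite_set [set n | ~ (U `&` F n !=set0)].

Definition winning_two_strategy (X : topologicalType) (s : two_strategy X) :=
  legal_two_strategy s /\
  forall D : nat -> set X, (forall n, dense (D n)) -> two_wins (two_answer s D).

Definition DHplus_separable (X : topologicalType) :=
  exists s : two_strategy X, winning_two_strategy s.

(* Main.v *)
Require Import Defs.
From mathcomp Require Import all_boot all_order all_algebra.
From mathcomp Require Import all_classical all_reals topology.

(** Put [g n x] for the intersection of the [G i (closure {x})], [i <= n].  If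
    [y] lies in an open set [U], then for some [n] the open set
    [V := ~` closure (G n (~` U))] contains [y], and by monotonicity of [G] any
    [x] such that some [g m x] with [m >= n] meets [V] must lie in [U].  Hence
    Two wins by answering [D_n] with a discrete [F_n] included in [D_n] such
    that the union of the [g n x], [x] in [F_n], is dense.  Such an [F_n] is
    read off a maximal disjoint family of open sets [O], each containing a
    marked point [x] of [D_n] and included in [g n x]. *)

Set Implicit Arguments.
Unset Strict Implicit.
Unset Printing Implicit Defensive.

Local Open Scope classical_set_scope.

Lemma isolated_discrete_subset (X : topologicalType) (F : set X) :
  (forall x, F x -> exists O, [/\ open O, O x & O `&` F `<=` [set x]]) ->
  discrete_subset F.
Proof.
move=> isoF B.
(* The largest open set with trace inside [B]; this avoids choosing an isolating [O] for each
   point. *)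
exists (\bigcup_(O in [set O | open O /\ set_val @^-1` O `<=` B]) O).
  by apply: bigcup_open => O [].
apply/seteqP; split=> [x [O [_ +] Ox]|x Bx]; first exact.
have [O [oO Ox OF]] := isoF _ (set_valP x).
exists O => //; split=> // z Oz.
suff -> : z = x by [].
by apply: val_inj; apply: OF; split=> //; exact: set_valP.
Qed.

Lemma dense_discrete_net (X : topologicalType) (D : set X) (g : X -> set X) :
  dense D -> (forall x, open (g x)) -> (forall x, g x x) ->
  exists F, [/\ F `<=` D, discrete_subset F & dense (\bigcup_(x in F) g x)].
Proof.
move=> dD og gx.
pose marked : set (X * set X) :=
  [set p | [/\ D p.1, open p.2, p.2 p.1 & p.2 `<=` g p.1]].
have [E [EM tE maxE]] := ex_maximal_disjoint_subcollection snd marked.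
exists (fst @` E); split.
- by move=> _ [p /EM[Dp _ _ _] <-].
- apply: isolated_discrete_subset => _ [p Ep <-].
  have [_ op pp _] := EM _ Ep.
  exists p.2; split=> // z [pz [q Eq qz]]; subst z.
  have [_ _ qq _] := EM _ Eq.
  (* [p.2] and [q.2] share [q.1], so disjointness forces [p = q]. *)
  by rewrite (tE _ _ Ep Eq) //; exists q.1.
- move=> W W0 oW; apply: contrapT => WE.
  have [d [Wd Dd]] := dD _ W0 oW.
  (* As [W] misses the union, [p] could be added to [E], against maximality. *)
  pose p := (d, W `&` g d).
  have pE q : E q -> p.2 `&` q.2 = set0.
    move=> Eq; apply/seteqP; split=> // z [[Wz _] qz].
    have [_ _ _ qg] := EM _ Eq.
    by apply: WE; exists z; split=> //; exists q.1; [exists q | exact: qg].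
  have NEp : ~ E p.
    by move=> /pE; rewrite setIid => /seteqP[/(_ d)] + _; apply; split.
  apply: (maxE (E `|` [set p])).
  + split; first exact: subsetUl.
    by move=> sub; apply: NEp; apply: sub; right.
  + move=> q [/EM//|->].
    by split=> //=; exact: openI.
  + move=> q r [Eq|->] [Er|->] //; first exact: tE.
      by rewrite setIC pE // => -[].
    by rewrite pE // => -[].
Qed.

Theorem corollary24 (X : topologicalType) :
  stratifiable X -> DHplus_separable X.
Proof.
move=> [G [Gopen Gcap Gmono]].
pose g n x := \bigcap_(i < n.+1) G i (closure [set x]).
have clx x : closed (closure [set x : X]) by exact: closed_closure.
have og n x : open (g n x).
  rewrite /g bigcap_mkord; apply: big_ind => [||i _].
  - exact: openT.
  - exact: openI.
  - exact: (Gopen i _ (clx x)).1.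
have gx n x : g n x x.
  by move=> i _; apply: (Gopen i _ (clx x)).2; exact: subset_closure.
(* Density sits under the existential so that [cid] applies to every [D]. *)
have net n (D : set X) : exists F, dense D ->
    [/\ F `<=` D, discrete_subset F & dense (\bigcup_(x in F) g n x)].
  have [dD|nD] := pselect (dense D); last by exists set0.
  by have [F FP] := dense_discrete_net dD (og n) (gx n); exists F.
pose net_of n D := projT1 (cid (net n D)).
(* At inning [n] the history has length [n.+1]; only its last move is used. *)
pose s (l : seq (set X)) := net_of (size l).-1 (last set0 l).
have sE D n : two_answer s D n = net_of n (D n).
  by rewrite /two_answer /s size_mkseq -nth_last size_mkseq nth_mkseq.
have sP D n : dense (D n) -> [/\ two_answer s D n `<=` D n,
    discrete_subset (two_answer s D n)
    & dense (\bigcup_(x in two_answer s D n) g n x)].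
  by rewrite sE; exact: (projT2 (cid (net n (D n)))).
exists s; split=> [D n dD|D dD U oU [y Uy]].
  by have [] := sP D n (dD n (leqnn n)).
have cU : closed (~` U) by exact: open_closedC.
have [n Vy] : exists n, ~ closure (G n (~` U)) y.
  apply: contrapT => /forallNP yG.
  have : (~` U) y by rewrite (Gcap _ cU) => i _; apply: contrapT; exact: yG.
  exact.
(* Only innings before [n] can fail. *)
apply: (sub_finite_set _ (finite_II n)) => m /= UF.
rewrite ltnNge; apply/negP => nm; apply: UF.
have [_ _ dF] := sP D m (dD m).
have [||z [Vz [x Fx gz]]] := dF (~` closure (G n (~` U))).
- by exists y.
- exact/closed_openC/closed_closure.
exists x; split=> //; apply: contrapT => Ux.
apply/Vz/subset_closure.
(* If [x] is outside [U], so is its closure; and [n <= m] puts [z] in [G n (closure [set x])]. *)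
apply: (Gmono n (closure [set x])) => //.
  by rewrite [X in _ `<=` X](iffLR (closure_id _) cU); apply: closureS => _ ->.
exact: gz.
Qed.
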